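(* Let $A = (a_{ij})_{i,j=1}^n$ be a real strictly row diagonally dominant matrix with $a_{ii} > 0$, $i = 1, \ldots, n$. Denote $s_i := \frac{\sum_{j\neq i}|a_{ij}|}{|a_{ii}|}$. Then $$\det A \leq \frac{1}{(1 - (\max_i s_i)^2)^{\frac{n}{2}}}\prod_{i=1}^n a_{ii}.$$
   Context: An $n \times n$ matrix $A$ is strictly row diagonally dominant if $|a_{ii}| > \sum_{j\neq i}|a_{ij}|$ for all $i = 1,\ldots,n$. *)

(* Defs.v *)
From mathcomp Require Import all_boot all_order all_algebra.

Set Implicit Arguments.
Unset Strict Implicit.
Unset Printing Implicit Defensive.

Import Order.TTheory GRing.Theory Num.Theory.
Local Open Scope ring_scope.

Definition strictly_row_diag_dominant (R : numDomainType) (n : nat)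
    (A : 'M[R]_n) : Prop :=
  forall i : 'I_n, \sum_(j < n | j != i) `|A i j| < `|A i i|.

Definition row_ratio (R : numFieldType) (n : nat) (A : 'M[R]_n) (i : 'I_n) : R :=
  (\sum_(j < n | j != i) `|A i j|) / `|A i i|.

(* The row ratios are nonnegative, so the initial value 0 of the iterated
   maximum does not affect its value for 0 < n. *)
Definition max_row_ratio (R : realFieldType) (n : nat) (A : 'M[R]_n) : R :=
  \big[Num.max/0]_(i < n) row_ratio A i.

(* Main.v *)
(** Hadamard's inequality bounds [(\det A)^2] by the product of the squared
    Euclidean norms of the rows.  With [s] the largest row ratio, the squared
    norm of row [i] is at most [(A i i)^2 (1 + s^2)], hence at most
    [(A i i)^2 / (1 - s^2)].  Hadamard's inequality follows by induction: a
    Householder reflection applied on the right sends the first row to a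
    multiple of the first basis vector and preserves the norms of all rows. *)
Require Import Defs.
From mathcomp Require Import all_boot all_order all_algebra.
From mathcomp Require Import ring lra.
From mathcomp Require Import reals exp.

Import Order.TTheory GRing.Theory Num.Theory.
Local Open Scope ring_scope.

Lemma mulmx_tr_diag (R : comPzRingType) (m n : nat) (A : 'M[R]_(m, n)) (i : 'I_m) :
  (A *m A^T) i i = \sum_j A i j ^+ 2.
Proof. by rewrite mxE; apply: eq_bigr => j _; rewrite mxE expr2. Qed.

Lemma mulmx_tr_eq0 (R : realDomainType) (n : nat) (u : 'rV[R]_n) :
  (u *m u^T) 0 0 = 0 -> u = 0.
Proof.
rewrite mulmx_tr_diag => /eqP.
rewrite psumr_eq0 => [/allP u0|j _]; last exact: sqr_ge0.
apply/rowP => j; rewrite mxE; apply/eqP.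
by rewrite -sqrf_eq0; apply: u0; rewrite mem_index_enum.
Qed.

(** The vector is a row, so the reflection acts by multiplication on the right. Since inversion
    sends 0 to 0, this is the identity matrix when [u *m u^T] vanishes. *)
Definition householder (R : fieldType) (n : nat) (u : 'rV[R]_n) : 'M[R]_n :=
  1%:M - (2 / (u *m u^T) 0 0) *: (u^T *m u).

Lemma mulmx_householder (R : fieldType) (m n : nat) (u : 'rV[R]_n) (x : 'M[R]_(m, n)) :
  x *m householder R n u = x - (2 / (u *m u^T) 0 0) *: (x *m u^T *m u).
Proof. by rewrite mulmxBr mulmx1 -scalemxAr mulmxA. Qed.

Lemma householder_tr (R : fieldType) (n : nat) (u : 'rV[R]_n) :
  (householder R n u)^T = householder R n u.
Proof. by rewrite linearB /= linearZ /= trmx1 trmx_mul trmxK. Qed.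

Lemma householderK (R : fieldType) (n : nat) (u : 'rV[R]_n) :
  householder R n u *m householder R n u = 1%:M.
Proof.
rewrite mulmx_householder {1 2}/householder.
set c := (u *m u^T) 0 0.
have uuE : u *m u^T = c%:M by exact: mx11_scalar.
rewrite mulmxBl mul1mx -scalemxAl -(mulmxA u^T) uuE mulmxBl -scalemxAl.
rewrite mul_mx_scalar -scalemxAl.
(* For [c != 0], the reflection sends [u^T *m u] to its opposite, so the two rank-one corrections
   cancel. *)
have [->|c0] := eqVneq c 0; first by rewrite invr0 mulr0 !scale0r !subr0.
set M := u^T *m u; rewrite scalerA divfK // scaler_nat.
by rewrite [M *+ 2]mulr2n opprD addrA subrr sub0r scalerN opprK subrK.
Qed.

(** Both [x] and [r *: delta_mx 0 0] have norm [r], so the reflection along their difference swaps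
    them. *)
Lemma householder_to_axis (R : rcfType) (n : nat) (x : 'rV[R]_n.+1)
    (r := Num.sqrt ((x *m x^T) 0 0)) :
  x *m householder R n.+1 (x - r *: delta_mx 0 0) = r *: delta_mx 0 0.
Proof.
set e := delta_mx 0 0; set u := x - r *: e.
have r2 : (x *m x^T) 0 0 = r ^+ 2.
  by rewrite sqr_sqrtr // mulmx_tr_diag sumr_ge0 // => j _; exact: sqr_ge0.
have xe : (x *m e^T) 0 0 = x 0 0 by rewrite trmx_delta -colE mxE.
have ex : (e *m x^T) 0 0 = x 0 0.
  by rewrite -[e *m x^T]trmxK trmx_mul trmxK mxE.
have ee : (e *m e^T) 0 0 = 1 by rewrite trmx_delta -colE !mxE !eqxx.
have subZE (M N : 'M[R]_1) : (M - r *: N) 0 0 = M 0 0 - r * N 0 0 by rewrite !mxE.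
have uT : u^T = x^T - r *: e^T by rewrite linearB /= linearZ.
have xu : (x *m u^T) 0 0 = r ^+ 2 - r * x 0 0.
  by rewrite uT mulmxBr -scalemxAr subZE r2 xe.
have eu : (e *m u^T) 0 0 = x 0 0 - r.
  by rewrite uT mulmxBr -scalemxAr subZE ex ee mulr1.
(* The equality of norms enters here: it makes the coefficient of [u] in the reflection of [x] equal
   to 1, leaving [x - u]. *)
have uu : (u *m u^T) 0 0 = 2 * (x *m u^T) 0 0.
  rewrite {1}/u mulmxBl -scalemxAl subZE eu xu; ring.
rewrite mulmx_householder.
have [u0|un0] := eqVneq u 0.
  by rewrite u0 mulmx0 scaler0 subr0; apply/eqP; rewrite -subr_eq0 -/u u0.
have uun0 : (u *m u^T) 0 0 != 0.
  by apply: contraNneq un0 => /mulmx_tr_eq0 ->.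
rewrite [x *m u^T]mx11_scalar mul_scalar_mx scalerA mulrAC -uu divff //.
by rewrite scale1r /u opprB addrC subrK.
Qed.

Theorem hadamard_inequality (R : rcfType) (n : nat) (A : 'M[R]_n) :
  \det A ^+ 2 <= \prod_i \sum_j A i j ^+ 2.
Proof.
elim: n A => [|n IHn] A; first by rewrite det_mx00 big_ord0 expr1n.
set r := Num.sqrt ((row 0 A *m (row 0 A)^T) 0 0).
set H := householder R n.+1 (row 0 A - r *: delta_mx 0 0).
have HH : H *m H^T = 1%:M by rewrite householder_tr householderK.
have detH : \det H ^+ 2 = 1 by rewrite expr2 -[in X in _ * X]det_tr -det_mulmx HH det1.
set B := A *m H.
have BB : B *m B^T = A *m A^T.
  by rewrite trmx_mul mulmxA -(mulmxA A) HH mulmx1.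
have rowB i : \sum_j B i j ^+ 2 = \sum_j A i j ^+ 2.
  by rewrite -!mulmx_tr_diag BB.
have B0 : row 0 B = r *: delta_mx 0 0 by rewrite row_mul householder_to_axis.
have B0E j : B 0 j = r * (j == 0)%:R.
  by have /rowP/(_ j) := B0; rewrite !mxE eqxx.
(* Squaring removes the unknown sign of [\det H]. *)
have -> : \det A ^+ 2 = \det B ^+ 2 by rewrite det_mulmx exprMn detH mulr1.
under eq_bigr do rewrite -rowB.
have -> : \det B = B 0 0 * \det (row' 0 (col' 0 B)).
  rewrite (expand_det_row B 0) big_ord_recl big1 ?addr0.
    by rewrite /cofactor expr0 mul1r.
  by move=> j _; rewrite B0E mulr0 mul0r.
rewrite exprMn big_ord_recl; apply: ler_pM; rewrite ?sqr_ge0 //.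
  by rewrite big_ord_recl lerDl sumr_ge0 // => j _; exact: sqr_ge0.
(* The minor lacks the first column of [B], which can only shrink the norms of the remaining
   rows. *)
apply: le_trans (IHn _) _; apply: ler_prod => i _.
rewrite sumr_ge0 => [|j _]; last exact: sqr_ge0.
have -> : \sum_j row' 0 (col' 0 B) i j ^+ 2
    = \sum_j B (lift 0 i) (lift 0 j) ^+ 2.
  by apply: eq_bigr => j _; rewrite !mxE.
by rewrite [leRHS]big_ord_recl lerDr sqr_ge0.
Qed.

Lemma sum_sqr_le_sqr_sum (R : realDomainType) (I : Type) (s : seq I) (P : pred I) (F : I -> R) :
  \sum_(i <- s | P i) F i ^+ 2 <= (\sum_(i <- s | P i) `|F i|) ^+ 2.
Proof.
(* Nonnegativity of the partial sum joins the induction because it makes the cross term of the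
   expanded square nonnegative. *)
suff [] : \sum_(i <- s | P i) F i ^+ 2 <= (\sum_(i <- s | P i) `|F i|) ^+ 2
    /\ 0 <= \sum_(i <- s | P i) `|F i| by [].
elim/big_rec2: _ => [|i y x _ [le_xy y0]]; first by rewrite expr0n.
have := real_normK (num_real (F i)); have := normr_ge0 (F i).
by split; nra.
Qed.

Lemma row_ratio_ge0 (R : realFieldType) (n : nat) (A : 'M[R]_n) (i : 'I_n) :
  0 <= row_ratio A i.
Proof. by rewrite divr_ge0 // sumr_ge0. Qed.

Lemma row_ratio_le_max (R : realFieldType) (n : nat) (A : 'M[R]_n) (i : 'I_n) :
  row_ratio A i <= max_row_ratio A.
Proof. exact: le_bigmax. Qed.

Lemma max_row_ratio_lt1 (R : realFieldType) (n : nat) (A : 'M[R]_n) :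
  strictly_row_diag_dominant A -> max_row_ratio A < 1.
Proof.
move=> A_dom; apply/bigmax_ltP; split => // i _.
rewrite /row_ratio ltr_pdivrMr ?mul1r //.
by apply: le_lt_trans (A_dom i); rewrite sumr_ge0.
Qed.

(** Off the diagonal, the Euclidean norm is at most the sum of absolute values, which is the row
    ratio times the diagonal entry in absolute value. *)
Lemma sum_sqr_row_le (R : realFieldType) (n : nat) (A : 'M[R]_n) (i : 'I_n) :
  A i i != 0 ->
  \sum_j A i j ^+ 2 <= A i i ^+ 2 * (1 + max_row_ratio A ^+ 2).
Proof.
move=> Aii0; rewrite (bigD1 i) //= mulrDr mulr1 lerD2l.
apply: le_trans (sum_sqr_le_sqr_sum _ _ _ _ _) _.
rewrite -(real_normK (num_real (A i i))) -exprMn.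
have -> : \sum_(j < n | j != i) `|A i j| = `|A i i| * row_ratio A i.
  by rewrite mulrC divfK // normr_eq0.
have r0 := row_ratio_ge0 R n A i; have rM := row_ratio_le_max R n A i.
rewrite lerXn2r ?nnegrE ?ler_wpM2l // mulr_ge0 //; exact: le_trans rM.
Qed.

Theorem theorem14 (R : realType) (n : nat) (n_gt0 : (0 < n)%N) (A : 'M[R]_n)
    (A_dom : strictly_row_diag_dominant A)
    (A_diag_gt0 : forall i : 'I_n, 0 < A i i) :
  \det A <=
    1 / ((1 - (max_row_ratio A) ^+ 2) `^ (n%:R / 2%:R)) * \prod_(i < n) A i i.
Proof.
set s := max_row_ratio A.
have s0 : 0 <= s by exact: le_trans (row_ratio_ge0 R n A (Ordinal n_gt0)) (row_ratio_le_max _ _ _ _).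
have s1 : s < 1 by exact: max_row_ratio_lt1.
have t0 : 0 < 1 - s ^+ 2 by nra.
have prod0 : 0 <= \prod_(i < n) A i i by rewrite prodr_ge0 // => i _; exact: ltW.
apply: le_trans (ler_norm _) _.
rewrite -ler_sqr ?nnegrE ?mulr_ge0 ?divr_ge0 ?invr_ge0 ?powR_ge0 //.
rewrite real_normK ?num_real //.
apply: le_trans (hadamard_inequality R n A) _.
(* Squaring turns the exponent [n / 2] into [n], giving one factor [(1 - s ^+ 2)^-1] per row. *)
have -> : (1 / ((1 - s ^+ 2) `^ (n%:R / 2%:R)) * \prod_(i < n) A i i) ^+ 2
    = \prod_(i < n) (A i i ^+ 2 * (1 - s ^+ 2)^-1).
  rewrite exprMn mul1r exprVn -powR_mulrn ?powR_ge0 // -powRrM divfK ?pnatr_eq0 //.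
  rewrite powR_mulrn ?(ltW t0) // big_split /= prodrXl mulrC.
  by rewrite prodr_const card_ord exprVn.
apply: ler_prod => i _; rewrite sumr_ge0 => [|j _]; last exact: sqr_ge0.
apply: le_trans (sum_sqr_row_le R n A i _) _; first by rewrite gt_eqF.
rewrite ler_wpM2l ?sqr_ge0 // -/s -[(_ - _)^-1]mul1r ler_pdivlMr //.
(* This is [(1 + s ^+ 2) * (1 - s ^+ 2) = 1 - s ^+ 4 <= 1]. *)
by have := sqr_ge0 (s ^+ 2); nra.
Qed.
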